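(* Let $(X,\Sigma_X,\mu_X)$ and $(Y,\Sigma_Y,\mu_Y)$ be measure spaces, where $\Sigma_X$, $\Sigma_Y$ are semirings of subsets of $X$, $Y$ (in particular, they may be $\sigma$-algebras) and $\mu_X$, $\mu_Y$ are $\sigma$-additive measures. For $D\subseteq X\times Y$ and $x\in X$ put $D^x:=\{y\in Y:(x,y)\in D\}$. (1) If $D\subseteq X\times Y$ and $(\mu_X\times\mu_Y)^*(D)=0$, then $\mu_Y^*(D^x)=0$ for $\mu_X$-almost all $x\in X$. (2) Conversely, suppose that $\mu_X$ and $\mu_Y$ are $\sigma$-finite measures. If $D\subseteq X\times Y$ is $(\mu_X\times\mu_Y)^*$-measurable and $\mu_Y^*(D^x)=0$ for $\mu_X$-almost all $x\in X$, then $(\mu_X\times\mu_Y)^*(D)=0$.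
   Context: A collection $\Sigma$ of subsets of a nonempty set $X$ is a semiring if (1) $\emptyset\in\Sigma$; (2) $A,B\in\Sigma$ implies $A\cap B\in\Sigma$; (3) for all $A,B\in\Sigma$ there exist pairwise disjoint $C_1,\dots,C_n\in\Sigma$ with $A\setminus B=\bigcup_{i=1}^n C_i$. A measure on a semiring $\Sigma$ is a function $\mu:\Sigma\to[0,\infty]$ with $\mu(\emptyset)=0$ such that $\mu(\bigcup_{n=1}^\infty A_n)=\sum_{n=1}^\infty\mu(A_n)$ for every pairwise disjoint sequence $(A_n)$ in $\Sigma$ whose union belongs to $\Sigma$ ($\sigma$-additivity). A measure space is a triplet $(X,\Sigma,\mu)$ with $\Sigma$ a semiring of subsets of $X$ and $\mu$ a measure on $\Sigma$. The measure $\mu$ is $\sigma$-finite if $X=\bigcup_{n\in\mathbb N}A_n$ for some $A_n\in\Sigma$ with $\mu(A_n)<\infty$. The outer measure $\mu^*$ generated by a set function $\mu:\mathcal F\to[0,\infty]$ with $\emptyset\in\mathcal F\subseteq\mathcal P(X)$ and $\mu(\emptyset)=0$ is defined for every $A\subseteq X$ by $\mu^*(A)=\inf\{\sum_{n=1}^\infty\mu(A_n): (A_n)\text{ a sequence in }\mathcal F\text{ with }A\subseteq\bigcup_{n=1}^\infty A_n\}$, and $\mu^*(A)=\infty$ if there is no such sequence. The product semiring is $\Sigma_X\otimes\Sigma_Y:=\{A\times B:A\in\Sigma_X,\ B\in\Sigma_Y\}$, and $\mu_X\times\mu_Y:\Sigma_X\otimes\Sigma_Y\to[0,\infty]$ is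 defined by $(\mu_X\times\mu_Y)(A\times B)=\mu_X(A)\cdot\mu_Y(B)$, with the convention $0\cdot\infty=0$; $(\mu_X\times\mu_Y)^*$ is the outer measure on $X\times Y$ it generates, and $\mu_X^*$, $\mu_Y^*$ are the outer measures generated by $\mu_X$, $\mu_Y$. A set is measurable with respect to an outer measure $\nu$ on $Z$ in the sense of Carathéodory: $D$ is $\nu$-measurable if $\nu(E)=\nu(E\cap D)+\nu(E\setminus D)$ for all $E\subseteq Z$. A property holds for $\mu_X$-almost all $x\in X$ if the set of $x\in X$ for which it fails has $\mu_X^*$-outer measure $0$. *)

(* Defs.v *)
From HB Require Import structures.
From mathcomp Require Import all_boot all_order all_algebra.
From mathcomp Require Import all_classical all_reals all_analysis.

Set Implicit Arguments.
Unset Strict Implicit.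
Unset Printing Implicit Defensive.

Import Order.TTheory GRing.Theory Num.Theory.

Local Open Scope classical_set_scope.
Local Open Scope ring_scope.
Local Open Scope ereal_scope.

(* A measure space (X, Sigma_X, mu_X) is a
   [semiRingOfSetsType] (pointed, hence nonempty; [measurable] is Sigma_X) with a
   [{measure set X -> \bar R}]. The latter is total on [set X], but only its
   values on measurable sets are used below. *)

(* The outer measure generated by mu restricted to the family F. When no sequence
   in F covers A, the infimum is taken over set0, so it is +oo. *)
Definition generated_outer (R : realType) (Z : Type) (F : set (set Z))
    (mu : set Z -> \bar R) (A : set Z) : \bar R :=
  ereal_inf [set \sum_(k <oo) mu (C k) |
    C in [set C : (set Z)^nat | (forall k, F (C k)) /\ A `<=` \bigcup_k C k]].

Lemma generated_outer_measurable (R : realType) (d : measure_display)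
    (X : semiRingOfSetsType d) (mu : set X -> \bar R) :
  generated_outer measurable mu = mu_ext mu.
Proof. by []. Qed.

Definition product_semiring (dX dY : measure_display)
    (X : semiRingOfSetsType dX) (Y : semiRingOfSetsType dY) :
    set (set (X * Y)) :=
  [set A `*` B | A in measurable & B in measurable].

(* The sides of a nonempty rectangle are its projections, and an empty rectangle
   gets value 0, so that A `*` B is sent to muX A * muY B in every case
   ([product_premeasureE]); in \bar R, 0 * +oo = 0. Only the values on rectangles
   matter: other sets never occur in [product_outer]. *)
Definition product_premeasure (R : realType) (dX dY : measure_display)
    (X : semiRingOfSetsType dX) (Y : semiRingOfSetsType dY)
    (muX : {measure set X -> \bar R}) (muY : {measure set Y -> \bar R})
    (C : set (X * Y)) : \bar R :=
  muX C.`1 * muY C.`2.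

Lemma product_premeasureE (R : realType) (dX dY : measure_display)
    (X : semiRingOfSetsType dX) (Y : semiRingOfSetsType dY)
    (muX : {measure set X -> \bar R}) (muY : {measure set Y -> \bar R})
    (A : set X) (B : set Y) :
  product_premeasure muX muY (A `*` B) = muX A * muY B.
Proof.
rewrite /product_premeasure.
have [->|/set0P[a Aa]] := eqVneq A set0.
  rewrite set0X (_ : set0.`1 = set0) ?measure0 ?mul0e//.
  by apply/seteqP; split => x // [].
have [->|/set0P[b Bb]] := eqVneq B set0.
  rewrite setX0 (_ : set0.`2 = set0) ?measure0 ?mule0//.
  by apply/seteqP; split => x // [].
congr (muX _ * muY _); apply/seteqP; split.
- exact: fst_setX.
- by move=> x Ax; exists b.
- exact: snd_setX.
- by move=> y By; exists a.
Qed.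

Definition product_outer (R : realType) (dX dY : measure_display)
    (X : semiRingOfSetsType dX) (Y : semiRingOfSetsType dY)
    (muX : {measure set X -> \bar R}) (muY : {measure set Y -> \bar R}) :
    set (X * Y) -> \bar R :=
  generated_outer (@product_semiring _ _ X Y) (product_premeasure muX muY).

(* The library's [{ae mu, P}] asks for a measurable superset of measure 0, which a
   mere semiring need not contain. *)
Definition outer_ae (R : realType) (d : measure_display)
    (X : semiRingOfSetsType d) (mu : {measure set X -> \bar R})
    (P : X -> Prop) : Prop :=
  mu_ext mu [set x | ~ P x] = 0.

(* Main.v *)
(* (1) A cover of D by rectangles A_k x B_k dominates x |-> muY^*(D^x) by the
   measurable function \sum_k 1_(A_k)(x) muY(B_k), whose integral is
   \sum_k muX(A_k) muY(B_k). Markov's inequality then bounds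
   e * muX^*{x | muY^*(D^x) >= e} by (muX x muY)^*(D).
   (2) By sigma-finiteness assume (muX x muY)^*(D) finite and take a hull G of D
   in the sigma-algebra generated by the rectangles. As D is Caratheodory
   measurable, G \ D is null, so by (1) almost all sections of G are null as well. On the
   generated sigma-algebra (muX x muY)^* is the integral of the measures of the
   sections, by uniqueness of the extension, so G is null. *)
Require Import Defs.
From HB Require Import structures.
From mathcomp Require Import all_boot all_order all_algebra.
From mathcomp Require Import all_classical all_reals all_analysis.
From mathcomp Require Import measurable_realfun.

Set Implicit Arguments.
Unset Strict Implicit.
Unset Printing Implicit Defensive.

Import Order.TTheory GRing.Theory Num.Theory.

Local Open Scope classical_set_scope.
Local Open Scope ring_scope.
Local Open Scope ereal_scope.

(** * Null sets of outer measures *)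

Lemma outer_measure_bigcup0 (R : realType) (T : Type)
    (nu : {outer_measure set T -> \bar R}) (F : (set T)^nat) :
  (forall n, nu (F n) = 0) -> nu (\bigcup_n F n) = 0.
Proof.
move=> F0; apply/eqP; rewrite eq_le outer_measure_ge0 andbT.
rewrite (le_trans (outer_measure_sigma_subadditive nu F))//.
by rewrite eseries0.
Qed.

Lemma outer_measure_sub0 (R : realType) (T : Type)
    (nu : {outer_measure set T -> \bar R}) (A B : set T) :
  A `<=` B -> nu B = 0 -> nu A = 0.
Proof.
move=> AB B0; apply/eqP; rewrite eq_le outer_measure_ge0 andbT -B0.
exact: le_outer_measure.
Qed.

(** * Sections of null sets, for part (1) *)

Section sections.
Context (R : realType) (dX dY : measure_display)
  (X : semiRingOfSetsType dX) (Y : semiRingOfSetsType dY)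
  (muX : {measure set X -> \bar R}) (muY : {measure set Y -> \bar R}).

Lemma mu_ext_xsection_le (A : (set X)^nat) (B : (set Y)^nat) (D : set (X * Y))
    x : (forall k, measurable (B k)) -> D `<=` \bigcup_k (A k `*` B k) ->
  mu_ext muY (xsection D x) <= \sum_(k <oo) (\1_(A k) x)%:E * muY (B k).
Proof.
move=> mB DAB; apply: ereal_inf_lbound.
(* Replacing [B k] by [set0] when [x] is outside [A k] makes the cost of the cover match the series
   term by term. *)
exists (fun k => if x \in A k then B k else set0) => [|/=]; last first.
  apply: eq_eseriesr => k _; rewrite indicE.
  by case: ifPn => _; rewrite ?mul1e// mul0e measure0.
split=> [k|y /xsectionP /DAB[k _ [/= Ax By]]].
  by case: ifPn => _ //; exact: measurable0.
by exists k => //; rewrite mem_set.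
Qed.

(* The function [x |-> muY^*(D^x)] need not be measurable, hence the detour
   through its measurable majorants. *)
Lemma xsection_markov (D : set (X * Y)) (e : R) : (0 < e)%R ->
  e%:E * mu_ext muX [set x | e%:E <= mu_ext muY (xsection D x)] <=
  product_outer muX muY D.
Proof.
move=> e0; apply: le_ereal_inf_tmp => _ [C [mC DC] <-].
have /choice[AB /all_and2[/all_and2[mA mB] CE]] :
    forall k, exists P : set X * set Y,
    (measurable P.1 /\ measurable P.2) /\ C k = P.1 `*` P.2.
  by move=> k; have [A mA [B mB <-]] := mC k; exists (A, B).
pose A k := (AB k).1; pose B k := (AB k).2.
have {}CE : C = fun k => A k `*` B k by apply/funext => k; rewrite CE.
rewrite {}CE {mC C} in DC *.
under eq_eseriesr do rewrite product_premeasureE.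
(* On the generated sigma-algebra [mu_ext muX] is a measure extending [muX], so one can integrate
   against it. *)
pose I : measurableType _ := g_sigma_algebraType (@measurable _ X).
pose m : {measure set I -> \bar R} := measure_extension muX.
have mAI k : measurable (A k : set I) by apply: sub_sigma_algebra; exact: mA.
pose g k (x : I) : \bar R := (\1_(A k : set I) x)%:E * muY (B k).
have g0 k x : 0 <= g k x by rewrite mule_ge0.
have mg k : measurable_fun setT (g k).
  by apply: emeasurable_funM => //; exact: measurableT_comp.
have -> : \sum_(k <oo) muX (A k) * muY (B k) =
    \int[m]_x \sum_(k <oo) g k x.
  rewrite integral_nneseries//; apply: eq_eseriesr => k _.
  rewrite ge0_integralZr//; last exact: measurableT_comp.
  rewrite integral_indic// setIT /m/= /measure_extension measurable_mu_extE//.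
  exact: mA.
have gE (x : I) : `|\sum_(k <oo) g k x| = \sum_(k <oo) g k x.
  by rewrite gee0_abs//; exact: nneseries_ge0.
have mG : measurable_fun setT (fun x : I => \sum_(k <oo) g k x).
  exact: ge0_emeasurable_sum.
have := @le_integral_comp_abse _ I R m _ measurableT _ e id
  (@measurable_id _ _ setT) (fun=> id) (fun _ _ _ _ => id) mG e0.
under [X in _ <= X]eq_integral do rewrite gE.
apply: le_trans; rewrite lee_pmul2l ?lte_fin//.
(* Monotonicity of [mu_ext] holds for arbitrary sets, so it suffices to include the level set of the
   sections in that of the majorant. *)
apply: le_mu_ext => x /= ex; split => //; rewrite gE.
apply: (le_trans ex); exact: mu_ext_xsection_le.
Qed.

(** The exceptional set is the union over [n] of the level sets at [1 / n.+1], each of which is null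
    by [xsection_markov]. *)
Lemma product_outer0_xsection (D : set (X * Y)) : product_outer muX muY D = 0 ->
  outer_ae muX (fun x => mu_ext muY (xsection D x) = 0).
Proof.
move=> D0.
apply: (@outer_measure_sub0 _ _ (mu_ext muX) _ (\bigcup_n
  [set x | (n.+1%:R^-1)%:E <= mu_ext muY (xsection D x)])).
  move=> x /= /eqP; rewrite neq_lt ltNge (mu_ext_ge0 (measure_ge0 muY))/=.
  case E: (mu_ext muY (xsection D x)) => [r| |]//; last first.
    by move=> _; exists 0%N => //=; rewrite E leey.
  rewrite lte_fin => /ltr_add_invr[n]; rewrite add0r => /ltW nr.
  by exists n => //=; rewrite E lee_fin.
apply: outer_measure_bigcup0 => n.
have := @xsection_markov D n.+1%:R^-1.
rewrite D0 invr_gt0 ltr0n => /(_ isT) h.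
apply/eqP; rewrite eq_le outer_measure_ge0 andbT.
by move: h; rewrite pmule_rle0// lte_fin.
Qed.
End sections.

(** * The semiring of rectangles *)

(* [X * Y] canonically carries the product sigma-algebra; this alias carries the
   semiring of measurable rectangles instead. *)
Definition rectangle_type (X Y : Type) : Type := (X * Y)%type.

(** Opaque, so that this display does not unify with the one of the product sigma-algebra. *)
Definition rectangle_display :
  measure_display * measure_display -> measure_display.
Proof. exact. Qed.

Section rectangle_semiring.
Context (dX dY : measure_display)
  (X : semiRingOfSetsType dX) (Y : semiRingOfSetsType dY).

Let rectangle0 : @product_semiring _ _ X Y set0.
Proof. by exists set0 => //; exists set0; rewrite ?set0X. Qed.

Let rectangleI : setI_closed (@product_semiring _ _ X Y).
Proof.
move=> _ _ [A mA [B mB <-]] [A' mA' [B' mB' <-]].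
exists (A `&` A'); first exact: measurableI.
by exists (B `&` B'); [exact: measurableI|rewrite setXI].
Qed.

(** (A x B) \ (A' x B') is the disjoint union of A x (B \ B') and (A \ A') x (B ∩ B'); the
    differences B \ B' and A \ A' are then split in their own semirings. *)
Let rectangleD : semi_setD_closed (@product_semiring _ _ X Y).
Proof.
move=> _ _ [A mA [B mB <-]] [A' mA' [B' mB' <-]].
have [DA [finDA mDA ADA tDA]] := semi_measurableD A A' mA mA'.
have [DB [finDB mDB BDB tDB]] := semi_measurableD B B' mB mB'.
have subDA a : DA a -> a `<=` A `\` A'.
  by move=> ?; rewrite ADA; exact: bigcup_sup.
have subDB b : DB b -> b `<=` B `\` B'.
  by move=> ?; rewrite BDB; exact: bigcup_sup.
exists ([set A `*` b | b in DB] `|` [set a `*` (B `&` B') | a in DA]); split.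
- by rewrite finite_setU; split; exact: finite_image.
- move=> _ [[b DBb <-]|[a DAa <-]].
    by exists A => //; exists b => //; exact: mDB.
  by exists a; [exact: mDA|exists (B `&` B') => //; exact: measurableI].
- apply/seteqP; split=> [[x y] [[/= Ax By] nA'B']|[x y]].
    have [B'y|B'y] := pselect (B' y).
      have : (A `\` A') x by split => // A'x; exact: nA'B'.
      rewrite ADA => -[a DAa ax].
      by exists (a `*` (B `&` B')) => //; right; exists a.
    have : (B `\` B') y by [].
    rewrite BDB => -[b DBb by_].
    by exists (A `*` b) => //; left; exists b.
  move=> [_ [[b DBb <-]|[a DAa <-]] [/= xa yb]].
    by have [] := subDB _ DBb _ yb; split => //; case.
  by have [] := subDA _ DAa _ xa; case: yb; split => //; case.
- move=> _ _ [[b DBb <-]|[a DAa <-]] [[b' DBb' <-]|[a' DAa' <-]] [[x y]/=] [].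
  + by move=> [_ yb] [_ yb']; rewrite (tDB b b')//; exists y.
  + by move=> [_ /(subDB _ DBb)[_ nB'y]] [_ [_]].
  + by move=> [_ [_ B'y]] [_ /(subDB _ DBb')[]].
  + by move=> [xa _] [xa' _]; rewrite (tDA a a')//; exists x.
Qed.

HB.instance Definition _ := Pointed.on (rectangle_type X Y).
HB.instance Definition _ := @isSemiRingOfSets.Build (rectangle_display (dX, dY))
  (rectangle_type X Y) (@product_semiring _ _ X Y)
  rectangle0 rectangleI rectangleD.

End rectangle_semiring.

(** * Measurable hulls *)

(* The hull is the intersection of covers of cost less than
   [mu^*(A) + 1 / n.+1]. *)
Lemma mu_ext_hull (R : realType) (d : measure_display)
    (T : semiRingOfSetsType d) (mu : {measure set T -> \bar R}) (A : set T) :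
  mu_ext mu A < +oo ->
  exists G : set T,
    [/\ <<s measurable >> G, A `<=` G & mu_ext mu G = mu_ext mu A].
Proof.
move=> Aoo.
have Afin : mu_ext mu A \is a fin_num.
  by rewrite ge0_fin_numE//; exact: mu_ext_ge0.
have /choice[C /all_and2[CA Cmu]] : forall n, exists C : (set T)^nat,
    measurable_cover A C /\
    \sum_(k <oo) mu (C k) < mu_ext mu A + (n.+1%:R^-1)%:E.
  move=> n; have n0 : (0 < n.+1%:R^-1 :> R)%R by rewrite invr_gt0 ltr0n.
  have [_ [C CA <-] Cmu] := lb_ereal_inf_adherent n0 Afin.
  by exists C.
pose G := \bigcap_n \bigcup_k C n k.
have AG : A `<=` G by move=> x Ax n _; exact: (cover_subset (CA n)).
exists G; split => //.
  pose I : measurableType _ := g_sigma_algebraType (@measurable _ T).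
  apply: (@bigcapT_measurable _ I) => n; apply: bigcupT_measurable => k.
  by apply: sub_sigma_algebra; exact: (cover_measurable (CA n)).
apply/eqP; rewrite eq_le; apply/andP; split; last exact: le_mu_ext.
(* A single cover [C n] with [1 / n.+1 < e] already covers [G]. *)
apply/lee_addgt0Pr => e e0.
have [n ne] := ltr_add_invr e0; rewrite add0r in ne.
rewrite (@le_trans _ _ (mu_ext mu A + (n.+1%:R^-1)%:E))//; last first.
  by rewrite leeD2l// lee_fin ltW.
rewrite (le_trans _ (ltW (Cmu n)))//; apply: ereal_inf_lbound.
exists (C n) => //; split=> [k|x Gx]; first exact: (cover_measurable (CA n)).
exact: Gx.
Qed.

(** * Sigma-finite factors, for part (2) *)

Section sigma_finite_product.
Context (R : realType) (dX dY : measure_display)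
  (X : semiRingOfSetsType dX) (Y : semiRingOfSetsType dY)
  (muX : {measure set X -> \bar R}) (muY : {measure set Y -> \bar R})
  (sfX : sigma_finite setT muX) (sfY : sigma_finite setT muY).

Let IX : measurableType _ := g_sigma_algebraType (@measurable _ X).
Let IY : measurableType _ := g_sigma_algebraType (@measurable _ Y).

Let mX : {measure set IX -> \bar R} := measure_extension muX.
(** Sigma-finiteness makes the measure of sections a measurable function, as the construction of
    [mX \x mY] requires. *)
Let mY : {sigma_finite_measure set IY -> \bar R} :=
  HB.pack (measure_extension muY)
    (@Measure_isSigmaFinite.Build _ _ _ (measure_extension muY)
       (measure_extension_sigma_finite sfY)).

Let mXY : {measure set (IX * IY) -> \bar R} := mX \x mY.

Let rectangle_measurable (C : set (rectangle_type X Y)) :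
  measurable C -> measurable (C : set (IX * IY)).
Proof.
by move=> [A mA [B mB <-]]; apply: measurableX; exact: sub_sigma_algebra.
Qed.

Let product_premeasure_mXY (C : set (rectangle_type X Y)) :
  measurable C -> product_premeasure muX muY C = mXY C.
Proof.
move=> [A mA [B mB <-]]; rewrite product_premeasureE.
transitivity (mX A * mY B).
  by congr (_ * _); apply/esym; exact: measurable_mu_extE.
by apply/esym/product_measure1E; exact: sub_sigma_algebra.
Qed.

Let premeasure (C : set (rectangle_type X Y)) : \bar R :=
  product_premeasure muX muY C.

Let premeasure0 : premeasure set0 = 0.
Proof.
rewrite /premeasure product_premeasure_mXY ?measure0//; exact: measurable0.
Qed.

Let premeasure_ge0 C : 0 <= premeasure C.
Proof. exact: mule_ge0. Qed.

(** Inherited from the product measure [mXY], which agrees with [premeasure] on rectangles. *)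
Let premeasure_sigma_additive : semi_sigma_additive premeasure.
Proof.
move=> F mF tF mUF; rewrite /premeasure product_premeasure_mXY//.
under eq_fun do under eq_bigr do rewrite product_premeasure_mXY//.
apply: (@measure_semi_sigma_additive _ _ _ mXY) => //.
- by move=> i; exact: rectangle_measurable.
- exact: rectangle_measurable.
Qed.

Let mu : {measure set (rectangle_type X Y) -> \bar R} :=
  HB.pack premeasure
    (isMeasure.Build _ _ _ premeasure premeasure0 premeasure_ge0
       premeasure_sigma_additive).

Let product_outerE : product_outer muX muY = mu_ext mu.
Proof. by []. Qed.

Let premeasure_sigma_finite : sigma_finite setT mu.
Proof.
have [F FT /all_and2[mF Foo]] := sfX; have [G GT /all_and2[mG Goo]] := sfY.
(* The default [(0, 0)] for codes of no pair is harmless, as every [F i x G j] has finite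
   measure. *)
exists (fun n => let p := odflt (0, 0)%N (unpickle n) in F p.1 `*` G p.2).
  apply/seteqP; split => // -[x y] _.
  have : [set: X] x by []. rewrite FT => -[i _ Fx].
  have : [set: Y] y by []. rewrite GT => -[j _ Gy].
  by exists (pickle (i, j)) => //=; rewrite pickleK.
move=> n /=; set p := odflt _ _; split.
  by exists (F p.1) => //; exists (G p.2).
rewrite /mu/= /premeasure product_premeasureE.
by rewrite lte_mul_pinfty// ge0_fin_numE.
Qed.

Let IXY : measurableType _ :=
  g_sigma_algebraType (@measurable _ (rectangle_type X Y)).

Let sigma_rectangle_measurable (G : set IXY) :
  measurable G -> measurable (G : set (IX * IY)).
Proof.
move: G; apply: smallest_sub; first exact: sigma_algebra_measurable.
exact: rectangle_measurable.
Qed.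

(** The restriction of [mXY] to the sigma-algebra generated by the rectangles, where the extension
    of [mu] is characterized by uniqueness. *)
Let mXY' (G : set IXY) : \bar R := mXY G.

Let mXY'0 : mXY' set0 = 0. Proof. exact: measure0. Qed.

Let mXY'_ge0 G : 0 <= mXY' G. Proof. exact: measure_ge0. Qed.

Let mXY'_sigma_additive : semi_sigma_additive mXY'.
Proof.
move=> F mF tF mUF; apply: (@measure_semi_sigma_additive _ _ _ mXY) => //.
- by move=> i; exact: sigma_rectangle_measurable.
- exact: sigma_rectangle_measurable.
Qed.

(** The integral is [mXY G] by definition of the product measure, and [mXY'] extends the
    sigma-finite [mu]. *)
Lemma product_outer_sigma_algebra (G : set (X * Y)) :
  <<s @product_semiring _ _ X Y >> G ->
  product_outer muX muY G =
  \int[measure_extension muX]_x mu_ext muY (xsection G x).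
Proof.
pose P : {measure set IXY -> \bar R} := HB.pack mXY'
  (isMeasure.Build _ _ _ mXY' mXY'0 mXY'_ge0 mXY'_sigma_additive).
move=> mG.
exact: (measure_extension_unique premeasure_sigma_finite (mu' := P)
  product_premeasure_mXY mG).
Qed.

Lemma xsection0_product_outer_fin (D : set (X * Y)) :
  caratheodory_measurable (product_outer muX muY) D ->
  product_outer muX muY D < +oo ->
  outer_ae muX (fun x => mu_ext muY (xsection D x) = 0) ->
  product_outer muX muY D = 0.
Proof.
move=> cD Doo D0.
have [G [mG DG GD]] := @mu_ext_hull _ _ _ mu D Doo.
rewrite -!product_outerE in GD.
have GD0 : product_outer muX muY (G `\` D) = 0.
  have Dfin : product_outer muX muY D \is a fin_num.
    by rewrite ge0_fin_numE//; exact: (outer_measure_ge0 (mu_ext mu)).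
  (* Testing measurability of [D] on [G] gives mu^*(D) = mu^*(D) + mu^*(G \ D), and the finite term
     cancels. *)
  have := cD G; rewrite setIidr// GD -setDE => DE.
  by rewrite -[LHS](addeK _ Dfin) addeC [X in _ + X]addeC -DE addeC subee.
have {}GD0 := product_outer0_xsection GD0.
rewrite -GD product_outer_sigma_algebra//.
pose h (x : IX) : \bar R := mY (xsection (G : set (IX * IY)) x).
have mh : measurable_fun setT h.
  exact: (measurable_fun_xsection mY (sigma_rectangle_measurable mG)).
have h0 : ae_eq mX setT h (cst 0).
  (* This set is measurable because [h] is. It is null because a section of [G] lies in the union of
     those of [G \ D] and [D]. *)
  exists [set x | h x != 0]; split.
  - by rewrite -[X in measurable X]setTI; exact: emeasurable_neq.
  - apply: (@outer_measure_sub0 _ _ (mu_ext muX) _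
      ([set x | mu_ext muY (xsection (G `\` D) x) <> 0] `|`
       [set x | mu_ext muY (xsection D x) <> 0])).
      move=> x; apply: contraPP => /= /not_orP[/contrapT GDx /contrapT Dx].
      apply/negP; rewrite negbK -[_ == _]/(mu_ext muY (xsection G x) == 0).
      rewrite eq_le (mu_ext_ge0 (measure_ge0 muY)) andbT.
      have := outer_measureU2 (mu_ext muY)
        (xsection (G `\` D) x) (xsection D x).
      rewrite /= GDx Dx adde0; apply: le_trans; apply: le_mu_ext => y Gxy.
      rewrite xsectionD.
      by have [?|?] := pselect (xsection D x y); [right|left].
    apply/eqP; rewrite eq_le outer_measure_ge0 andbT.
    apply: (le_trans (outer_measureU2 (mu_ext muX) _ _)).
    by rewrite /= [X in X + _]GD0 [X in _ + X]D0 adde0.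
  - by move=> x /= /not_implyP[_ /eqP].
by rewrite (ae_eq_integral (cst 0) _ _ _ _ h0) ?integral0.
Qed.

(** Cut [D] along countably many rectangles of finite measure: each piece is still Caratheodory
    measurable, has finite outer measure, and has smaller sections. *)
Lemma xsection0_product_outer (D : set (X * Y)) :
  caratheodory_measurable (product_outer muX muY) D ->
  outer_ae muX (fun x => mu_ext muY (xsection D x) = 0) ->
  product_outer muX muY D = 0.
Proof.
move=> cD D0; have [F FT /all_and2[mF Foo]] := premeasure_sigma_finite.
rewrite -[D]setIT FT setI_bigcupr.
apply: (@outer_measure_bigcup0 _ _ (mu_ext mu)) => n.
apply: xsection0_product_outer_fin.
- apply: (@caratheodory_measurable_setI _ _ (mu_ext mu)) => //.
  exact: caratheodory_measurable_mu_ext.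
- apply: le_lt_trans (Foo n); rewrite -(measurable_mu_extE mu (mF n)).
  by apply: (le_mu_ext mu) => x [].
- apply: (@outer_measure_sub0 _ _ (mu_ext muX)) D0 => x.
  apply: contra_not => Dx.
  apply: (@outer_measure_sub0 _ _ (mu_ext muY)) Dx.
  by rewrite xsectionI.
Qed.

End sigma_finite_product.

Theorem corollary2 (R : realType) (dX dY : measure_display)
    (X : semiRingOfSetsType dX) (Y : semiRingOfSetsType dY)
    (muX : {measure set X -> \bar R}) (muY : {measure set Y -> \bar R}) :
  (forall D : set (X * Y),
     product_outer muX muY D = 0 ->
     outer_ae muX (fun x => mu_ext muY (xsection D x) = 0)) /\
  (sigma_finite setT muX -> sigma_finite setT muY ->
   forall D : set (X * Y),
     caratheodory_measurable (product_outer muX muY) D ->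
     outer_ae muX (fun x => mu_ext muY (xsection D x) = 0) ->
     product_outer muX muY D = 0).
Proof.
split=> [D|sfX sfY D]; first exact: product_outer0_xsection.
exact: xsection0_product_outer.
Qed.
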